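(* Let $\mathcal G$ be a graph on $n$ vertices with adjacency matrix $A$, and let $\tau>0$. Define the smoothed joint probability estimate $$\widehat p_\tau(j,k)=\frac{N}{N+n\tau}\,\widetilde p(j,k)+\frac{n\tau}{N+n\tau}\cdot\frac1{n^2},\qquad 1\le j,k\le n .$$ This is equivalent to replacing the adjacency matrix $A$ by $A_\tau=A+(\tau/n)\mathbf 1\mathbf 1^{T}$, that is, $\widehat p_\tau(j,k)=A_\tau(j,k)/\sum_{x,y}A_\tau(x,y)$. Moreover, replacing $\widetilde p(j,k)$ by $\widehat p_\tau(j,k)$ in the regularized estimating equation $$\sum_{j}\theta_{j}\left[\frac{\widetilde p(j,k)}{\sqrt{\widehat p_\tau(j)\widehat p_\tau(k)}}-\sqrt{\widehat p_\tau(j)}\sqrt{\widehat p_\tau(k)}-\lambda\delta_{jk}\right]=0,\qquad k=1,\dots,n,$$ leads to the spectral graph matrix $D_\tau^{-1/2}A_\tau D_\tau^{-1/2}$ (the Type-II regularized Laplacian): for all $j,k$, $$\frac{\widehat p_\tau(j,k)}{\sqrt{\widehat p_\tau(j)\,\widehat p_\tau(k)}}=\big(D_\tau^{-1/2}A_\tau D_\tau^{-1/2}\big)_{jk}.$$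
   Context: $\mathcal G$ is an undirected, possibly weighted, graph with vertex set $\{1,\dots,n\}$, at least one edge, and symmetric adjacency matrix $A$ with nonnegative entries; $d_j=\sum_kA(j,k)$ is the degree of $j$; $N=\sum_{j,k}A(j,k)$; $\mathbf 1$ is the all-ones vector in $\mathbb R^n$; $D_\tau$ is the diagonal matrix with $i$-th diagonal entry $d_i+\tau$. The empirical joint estimate is $\widetilde p(j,k)=A(j,k)/N$, and the smoothed (Laplace/additive) vertex probability estimate is $$\widehat p_\tau(j)=\frac{d_j+\tau}{N+n\tau}.$$ $\delta_{jk}$ is the Kronecker delta. In the estimating equation, the term $\sqrt{\widehat p_\tau(j)}\sqrt{\widehat p_\tau(k)}$ is the rank-one correction coming from subtracting $1$ from the graph correlation density kernel, and the ''spectral graph matrix'' is the matrix whose entries are the first term in the bracket. *)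

(* Defs.v *)
From HB Require Import structures.
From mathcomp Require Import all_boot all_order all_algebra.
Set Implicit Arguments.
Unset Strict Implicit.
Unset Printing Implicit Defensive.
Import Order.TTheory GRing.Theory Num.Theory.
Local Open Scope ring_scope.

(* Self-loops (nonzero diagonal entries) are allowed. *)
Definition weighted_graph (R : rcfType) (n : nat) (A : 'M[R]_n) : Prop :=
  [/\ A^T = A, forall j k, 0 <= A j k & exists j k, 0 < A j k].

Definition degree (R : rcfType) (n : nat) (A : 'M[R]_n) (j : 'I_n) : R :=
  \sum_k A j k.

Definition total (R : rcfType) (n : nat) (A : 'M[R]_n) : R :=
  \sum_j \sum_k A j k.

Definition joint_estimate (R : rcfType) (n : nat) (A : 'M[R]_n) : 'M[R]_n :=
  \matrix_(j, k) (A j k / total A).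

Definition smoothed_vertex_estimate (R : rcfType) (n : nat) (A : 'M[R]_n)
    (tau : R) (j : 'I_n) : R :=
  (degree A j + tau) / (total A + n%:R * tau).

Definition smoothed_joint_estimate (R : rcfType) (n : nat) (A : 'M[R]_n)
    (tau : R) : 'M[R]_n :=
  \matrix_(j, k)
    (total A / (total A + n%:R * tau) * joint_estimate A j k
     + n%:R * tau / (total A + n%:R * tau) * (1 / n%:R ^+ 2)).

Definition smoothed_adjacency (R : rcfType) (n : nat) (A : 'M[R]_n)
    (tau : R) : 'M[R]_n :=
  A + (tau / n%:R) *: ((const_mx 1 : 'cV[R]_n) *m (const_mx 1 : 'cV[R]_n)^T).

Definition smoothed_degree_mx (R : rcfType) (n : nat) (A : 'M[R]_n)
    (tau : R) : 'M[R]_n :=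
  diag_mx (\row_i (degree A i + tau)).

(* The power -1/2 of a diagonal matrix with positive diagonal; only the
   diagonal of D is read (see diag_invsqrtP). *)
Definition diag_invsqrt (R : rcfType) (n : nat) (D : 'M[R]_n) : 'M[R]_n :=
  diag_mx (\row_i (Num.sqrt (D i i))^-1).

Lemma diag_invsqrtP (R : rcfType) (n : nat) (d : 'rV[R]_n) :
  (forall i, 0 < d 0 i) ->
  diag_invsqrt (diag_mx d) *m diag_invsqrt (diag_mx d) = invmx (diag_mx d).
Proof.
move=> d_gt0; set E := diag_invsqrt _.
have EED : (E *m E) *m diag_mx d = 1%:M.
  rewrite !mulmx_diag -diag_const_mx; congr diag_mx; apply/rowP=> i.
  rewrite !mxE eqxx mulr1n -invfM -expr2 sqr_sqrtr ?ltW // mulVf //.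
  by rewrite gt_eqF.
have [_ uD] := mulmx1_unit EED.
by rewrite -[LHS]mulmx1 -(mulmxV uD) mulmxA EED mul1mx.
Qed.

(* P is the joint estimate and p the vertex estimate plugged into the
   equation. *)
Definition spectral_graph_matrix (R : rcfType) (n : nat) (P : 'M[R]_n)
    (p : 'I_n -> R) : 'M[R]_n :=
  \matrix_(j, k) (P j k / Num.sqrt (p j * p k)).

Definition estimating_equation (R : rcfType) (n : nat) (P : 'M[R]_n)
    (p : 'I_n -> R) (theta : 'I_n -> R) (lambda : R) : Prop :=
  forall k : 'I_n,
    \sum_j theta j * (P j k / Num.sqrt (p j * p k)
                      - Num.sqrt (p j) * Num.sqrt (p k)
                      - lambda * (j == k)%:R) = 0.

Definition typeII_laplacian (R : rcfType) (n : nat) (A : 'M[R]_n)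
    (tau : R) : 'M[R]_n :=
  diag_invsqrt (smoothed_degree_mx A tau) *m smoothed_adjacency A tau
    *m diag_invsqrt (smoothed_degree_mx A tau).

(* Main.v *)
Require Import Defs.
From HB Require Import structures.
From mathcomp Require Import all_boot all_order all_algebra.
From mathcomp Require Import ring.
Import Order.TTheory GRing.Theory Num.Theory.
Local Open Scope ring_scope.

(** Write [N] for the total weight and [d j] for the degrees.  Since the
    constant matrix of entries [tau / n] has total weight [n * tau], the
    smoothed adjacency matrix has total weight [N + n * tau]; the factor [N]
    of the convex combination defining the smoothed joint estimate cancels the
    normalisation of the empirical one, so that this estimate has entries
    [(A j k + tau / n) / (N + n * tau)] ([smoothed_joint_estimateE]).

    In the kernel ratio, the vertex estimates [(d j + tau) / (N + n * tau)]
    contribute the same factor [N + n * tau]: the product under the square root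
    carries its square, hence the root carries the factor itself, and it cancels
    against the normalisation of the joint estimate.  What remains,
    [(A j k + tau / n) / (sqrt (d j + tau) * sqrt (d k + tau))], is the entry of
    the Type-II Laplacian ([spectral_graph_matrix_smoothed]).  The equivalence
    of the estimating equations is then a termwise substitution. *)

Lemma weighted_graph_order_gt0 {R : rcfType} {n : nat} {A : 'M[R]_n} :
  weighted_graph A -> (0 < n)%N.
Proof. by case=> _ _ [j _]; apply: leq_ltn_trans (ltn_ord j). Qed.

Lemma degree_ge0 {R : rcfType} {n : nat} {A : 'M[R]_n} (j : 'I_n) :
  weighted_graph A -> 0 <= degree A j.
Proof. by case=> _ A_ge0 _; apply: sumr_ge0. Qed.

(** The existence of an edge is what makes the empirical joint estimate
    well defined. *)
Lemma total_gt0 {R : rcfType} {n : nat} {A : 'M[R]_n} :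
  weighted_graph A -> 0 < Defs.total A.
Proof.
move=> hA; case: (hA) => _ A_ge0 [j [k Ajk_gt0]].
have dj_gt0 : 0 < degree A j.
  rewrite /degree (bigD1 k) //= ltr_wpDr //.
  by apply: sumr_ge0 => i _; apply: A_ge0.
rewrite /Defs.total (bigD1 j) //= ltr_wpDr //.
by apply: sumr_ge0 => i _; apply: degree_ge0.
Qed.

Lemma smoothed_adjacencyE {R : rcfType} {n : nat} (A : 'M[R]_n) (tau : R) j k :
  smoothed_adjacency A tau j k = A j k + tau / n%:R.
Proof. by rewrite !mxE big_ord1 !mxE !mulr1. Qed.

Lemma total_smoothed_adjacency {R : rcfType} {n : nat} (A : 'M[R]_n) (tau : R) :
  (0 < n)%N -> Defs.total (smoothed_adjacency A tau) = Defs.total A + n%:R * tau.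
Proof.
move=> n_gt0; have n_neq0 : n%:R != 0 :> R by rewrite pnatr_eq0 -lt0n.
rewrite /Defs.total -[n in n%:R * tau]card_ord mulr_natl -sumr_const -big_split /=.
apply: eq_bigr => j _.
under eq_bigr do rewrite smoothed_adjacencyE.
by rewrite big_split /= sumr_const card_ord -[_ *+ n]mulr_natr divfK.
Qed.

(** A convex combination of [A / N] and the uniform distribution, with weights
    proportional to [N] and [n * tau], is a sum of unnormalised weights divided
    by their total. *)
Lemma smoothed_joint_estimateE {R : rcfType} {n : nat} {A : 'M[R]_n} {tau : R} :
  weighted_graph A -> 0 < tau ->
  smoothed_joint_estimate A tau = joint_estimate (smoothed_adjacency A tau).
Proof.
move=> hA tau_gt0; have n_gt0 := weighted_graph_order_gt0 hA.
have n_neq0 : n%:R != 0 :> R by rewrite pnatr_eq0 -lt0n.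
have N_gt0 := total_gt0 hA.
have M_neq0 : Defs.total A + n%:R * tau != 0.
  by rewrite gt_eqF // addr_gt0 // mulr_gt0 // ltr0n.
apply/matrixP => j k; rewrite 3!mxE total_smoothed_adjacency //.
rewrite smoothed_adjacencyE; field.
by rewrite M_neq0 n_neq0 gt_eqF.
Qed.

Lemma typeII_laplacianE {R : rcfType} {n : nat} (A : 'M[R]_n) (tau : R) j k :
  typeII_laplacian A tau j k
  = (Num.sqrt (degree A j + tau))^-1 * smoothed_adjacency A tau j k
    * (Num.sqrt (degree A k + tau))^-1.
Proof.
rewrite /typeII_laplacian /diag_invsqrt mul_mx_diag mul_diag_mx.
by rewrite /smoothed_degree_mx !mxE !eqxx !mulr1n.
Qed.

Lemma sqrt_smoothed_vertex_estimateM {R : rcfType} {n : nat} {A : 'M[R]_n}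
    {tau : R} (j k : 'I_n) :
  weighted_graph A -> 0 < tau ->
  Num.sqrt (smoothed_vertex_estimate A tau j * smoothed_vertex_estimate A tau k)
  = Num.sqrt (degree A j + tau) * Num.sqrt (degree A k + tau)
    / (Defs.total A + n%:R * tau).
Proof.
move=> hA tau_gt0; have dj_ge0 := degree_ge0 j hA.
have M_ge0 : 0 <= Defs.total A + n%:R * tau.
  by rewrite addr_ge0 ?mulr_ge0 ?ler0n ?ltW // total_gt0.
rewrite /smoothed_vertex_estimate mulrACA -invfM -expr2.
rewrite sqrtrM ?mulr_ge0 ?addr_ge0 ?degree_ge0 ?(ltW tau_gt0) //.
rewrite sqrtrM ?addr_ge0 ?(ltW tau_gt0) // sqrtrV ?sqr_ge0 //.
by rewrite sqrtr_sqr ger0_norm.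
Qed.

(** Both the joint estimate and the square root of the vertex estimates are
    normalised by [N + n * tau], which therefore drops out of their ratio. *)
Lemma spectral_graph_matrix_smoothed {R : rcfType} {n : nat} {A : 'M[R]_n}
    {tau : R} :
  weighted_graph A -> 0 < tau ->
  spectral_graph_matrix (smoothed_joint_estimate A tau)
    (smoothed_vertex_estimate A tau) = typeII_laplacian A tau.
Proof.
move=> hA tau_gt0; apply/matrixP => j k.
have n_gt0 := weighted_graph_order_gt0 hA.
have M_neq0 : Defs.total A + n%:R * tau != 0.
  by rewrite gt_eqF // addr_gt0 ?total_gt0 // mulr_gt0 // ltr0n.
have sqrt_neq0 i : Num.sqrt (degree A i + tau) != 0.
  by rewrite gt_eqF // sqrtr_gt0 ltr_wpDl // degree_ge0.
rewrite typeII_laplacianE mxE smoothed_joint_estimateE // mxE.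
rewrite total_smoothed_adjacency // sqrt_smoothed_vertex_estimateM //.
by field; rewrite M_neq0 !sqrt_neq0.
Qed.

Theorem theorem9 (R : rcfType) (n : nat) (A : 'M[R]_n) (tau : R)
    (hA : weighted_graph A) (htau : 0 < tau) :
  [/\ smoothed_joint_estimate A tau = joint_estimate (smoothed_adjacency A tau),
      forall j k : 'I_n,
        smoothed_joint_estimate A tau j k
        = smoothed_adjacency A tau j k
          / (\sum_x \sum_y smoothed_adjacency A tau x y),
      forall (theta : 'I_n -> R) (lambda : R),
        estimating_equation (smoothed_joint_estimate A tau)
          (smoothed_vertex_estimate A tau) theta lambda
        <-> (forall k : 'I_n,
              \sum_j theta j *
                (typeII_laplacian A tau j k
                 - Num.sqrt (smoothed_vertex_estimate A tau j)
                   * Num.sqrt (smoothed_vertex_estimate A tau k)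
                 - lambda * (j == k)%:R) = 0),
      spectral_graph_matrix (smoothed_joint_estimate A tau)
        (smoothed_vertex_estimate A tau) = typeII_laplacian A tau
    & forall j k : 'I_n,
        smoothed_joint_estimate A tau j k
        / Num.sqrt (smoothed_vertex_estimate A tau j
                    * smoothed_vertex_estimate A tau k)
        = (diag_invsqrt (smoothed_degree_mx A tau)
           *m smoothed_adjacency A tau
           *m diag_invsqrt (smoothed_degree_mx A tau)) j k].
Proof.
have kernelE j k :
    smoothed_joint_estimate A tau j k
    / Num.sqrt (smoothed_vertex_estimate A tau j
                * smoothed_vertex_estimate A tau k)
    = typeII_laplacian A tau j k.
  by rewrite -spectral_graph_matrix_smoothed // [RHS]mxE.
split.
- exact: smoothed_joint_estimateE.
- by move=> j k; rewrite smoothed_joint_estimateE // mxE.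
- move=> theta lambda; rewrite /estimating_equation.
  by split=> eq0 k; rewrite -[RHS](eq0 k); apply: eq_bigr => j _; rewrite kernelE.
- exact: spectral_graph_matrix_smoothed.
- exact: kernelE.
Qed.
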